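(* Let $k\ge 2$ and let $M_1^{k-1}$ and $M_2^{k-1}$ be two compact, immersed minimal hypersurfaces of $S^k$. Let $\nu\in S^k$ and let $r\le\frac{\pi}{2}$ be a number such that $M_i\cap B(\nu,r)\neq\emptyset$ for each $i\in\{1,2\}$, but $$M_1\cap M_2\cap\overline{B(\nu,r)}=\emptyset.$$ Let $a\in M_1\cap\overline{B(\nu,r)}$ and $b\in M_2\cap\overline{B(\nu,r)}$ be such that $$\operatorname{dist}_{\overline{B(\nu,r)}}(M_1,M_2)=\operatorname{dist}(a,b).$$ Then either $a\in\partial B(\nu,r)$ or $b\in\partial B(\nu,r)$.
   Context: $S^k\subset\mathbb{R}^{k+1}$ is the unit sphere with its standard round metric, and $\operatorname{dist}$ is the geodesic distance on $S^k$. $B(\nu,r)=\{p\in S^k:\operatorname{dist}(p,\nu)<r\}$ is the open geodesic ball, $\overline{B(\nu,r)}$ its closure and $\partial B(\nu,r)$ its boundary. $\operatorname{dist}_{\overline{B(\nu,r)}}(M_1,M_2)$ denotes the distance between $M_1$ and $M_2$ inside the closed ball, i.e. $\inf\{\operatorname{dist}(x,y): x\in M_1\cap\overline{B(\nu,r)},\ y\in M_2\cap\overline{B(\nu,r)}\}$. All manifolds are connected, complete and without boundary. An immersed hypersurface $M^{k-1}$ of $S^k$ is a $(k-1)$-dimensional manifold with an immersion into $S^k$; when intersections with other sets are taken, $M$ is identified with the image of the immersion. With $N$ a (local) unit normal field along $M$ and $\{e_i\}_{i=1}^{k-1}$ a local orthonormal frame tangent to $M$, the mean curvature is $H=\frac{1}{k-1}\sum_{i=1}^{k-1}\langle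 D_{e_i}N,e_i\rangle$; $M$ is minimal if $H$ vanishes identically. ''Either ... or'' is understood inclusively. *)

(* Defs.v *)
From HB Require Import structures.
From mathcomp Require Import all_boot all_order all_algebra.
From mathcomp Require Import all_classical all_reals all_analysis.
Set Implicit Arguments.
Unset Strict Implicit.
Unset Printing Implicit Defensive.
Import Order.TTheory GRing.Theory Num.Theory.
Import numFieldNormedType.Exports.
Local Open Scope classical_set_scope.
Local Open Scope ring_scope.

(* The norm of the library on ['rV[R]_n] is the sup norm: it is used for the
   topology and for differentiation only. Euclidean quantities go through
   [dot]. *)
Definition dot (R : realType) (n : nat) (u v : 'rV[R]_n) : R :=
  \sum_(i < n) u 0 i * v 0 i.

Definition enorm (R : realType) (n : nat) (u : 'rV[R]_n) : R :=
  Num.sqrt (dot u u).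

Definition sphere (R : realType) (k : nat) : set 'rV[R]_k.+1 :=
  [set p | dot p p = 1].

(* A C^1 curve on [0, 1] is the restriction of a C^1 curve of the ambient space
   defined on the whole line; only its part over [0, 1] has to lie on the
   sphere. *)
Definition sphere_curve (R : realType) (k : nat) (c : R -> 'rV[R]_k.+1)
    (p q : 'rV[R]_k.+1) : Prop :=
  [/\ forall t, derivable c t 1,
      continuous (c^`())%classic,
      forall t, 0 <= t <= 1 -> sphere (c t),
      c 0 = p & c 1 = q].

Definition curve_length (R : realType) (k : nat) (c : R -> 'rV[R]_k.+1) : R :=
  \int[lebesgue_measure]_(t in `[0, 1]) enorm ((c^`())%classic t).

Definition geodist (R : realType) (k : nat) (p q : 'rV[R]_k.+1) : R :=
  inf [set curve_length c | c in [set c | sphere_curve c p q]].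

Definition geoball (R : realType) (k : nat) (nu : 'rV[R]_k.+1) (r : R) :
    set 'rV[R]_k.+1 :=
  [set p | sphere p /\ geodist p nu < r].

(* The sphere is closed in the ambient space, so for a subset of the sphere the
   ambient closure is the closure in the sphere. *)
Definition geoball_closure (R : realType) (k : nat) (nu : 'rV[R]_k.+1)
    (r : R) : set 'rV[R]_k.+1 :=
  closure (geoball nu r).

(* Boundary relative to the sphere, not to the ambient space. *)
Definition geoball_boundary (R : realType) (k : nat) (nu : 'rV[R]_k.+1)
    (r : R) : set 'rV[R]_k.+1 :=
  closure (geoball nu r) `&` closure (@sphere R k `\` geoball nu r).

Definition dist_in (R : realType) (k : nat) (C A1 A2 : set 'rV[R]_k.+1) : R :=
  inf [set geodist x y | x in A1 `&` C & y in A2 `&` C].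

(* Only used with [U] open. *)
Fixpoint Cn_on (R : realType) (m p : nat) (n : nat) (U : set 'rV[R]_m)
    (f : 'rV[R]_m -> 'rV[R]_p) : Prop :=
  match n with
  | 0 => forall x, U x -> {for x, continuous f}
  | n'.+1 => (forall x, U x -> differentiable f x) /\
             (forall v : 'rV[R]_m, Cn_on n' U ('D_v f))
  end.

Definition smooth_on (R : realType) (m p : nat) (U : set 'rV[R]_m)
    (f : 'rV[R]_m -> 'rV[R]_p) : Prop :=
  forall n : nat, Cn_on n U f.

(* [chart_map] and [chart_inv] are total; they are mutually inverse
   homeomorphisms between [chart_dom] and its image, and arbitrary outside. *)
Record chart (R : realType) (T : topologicalType) (n : nat) := Chart {
  chart_dom : set T;
  chart_map : T -> 'rV[R]_n;
  chart_inv : 'rV[R]_n -> T;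
  chart_dom_open : open chart_dom;
  chart_img_open : open (chart_map @` chart_dom);
  chart_mapK : forall p, chart_dom p -> chart_inv (chart_map p) = p;
  chart_map_cts : forall p, chart_dom p -> {for p, continuous chart_map};
  chart_inv_cts : forall x, (chart_map @` chart_dom) x ->
    {for x, continuous chart_inv} }.

Definition chart_img (R : realType) (T : topologicalType) (n : nat)
    (c : chart R T n) : set 'rV[R]_n :=
  chart_map c @` chart_dom c.

(* Connectedness is part of the structure. *)
Record manifold (R : realType) (n : nat) := Manifold {
  carrier :> topologicalType;
  atlas : set (chart R carrier n);
  manifold_hausdorff : hausdorff_space carrier;
  manifold_countable : @second_countable carrier;
  manifold_connected : connected [set: carrier];
  atlas_cover : forall p : carrier, exists2 c, atlas c & chart_dom c p;
  atlas_smooth : forall c d, atlas c -> atlas d ->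
    smooth_on (chart_map c @` (chart_dom c `&` chart_dom d))
              (chart_map d \o chart_inv c) }.

Record hypersurface (R : realType) (k : nat) := Hypersurface {
  source :> manifold R k.-1;
  imm : source -> 'rV[R]_k.+1;
  imm_sphere : forall p, sphere (imm p);
  imm_smooth : forall c, atlas c ->
    smooth_on (chart_img c) (imm \o chart_inv c);
  imm_immersive : forall c x, atlas c -> chart_img c x ->
    injective ('d (imm \o chart_inv c) x) }.

Definition image_of (R : realType) (k : nat) (M : hypersurface R k) :
    set 'rV[R]_k.+1 :=
  range (@imm R k M).

Definition compact_hypersurface (R : realType) (k : nat)
    (M : hypersurface R k) : Prop :=
  compact [set: M].

(* [X] is a local parametrization of the hypersurface and the field [N] along it
   is read in the same coordinates. A differentiable unit normal field is
   automatically smooth. *)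
Definition unit_normal_field (R : realType) (k : nat)
    (X N : 'rV[R]_k.-1 -> 'rV[R]_k.+1) (W : set 'rV[R]_k.-1) : Prop :=
  forall x, W x ->
    [/\ differentiable N x,
        dot (N x) (N x) = 1,
        dot (N x) (X x) = 0 &
        forall w : 'rV[R]_k.-1, dot (N x) ('d X x w) = 0].

(* The tangent frame at [X x] is e_i = dX_x(w_i), with w_i its coordinates. *)
Definition orthonormal_frame (R : realType) (k : nat)
    (X : 'rV[R]_k.-1 -> 'rV[R]_k.+1) (x : 'rV[R]_k.-1)
    (w : 'I_k.-1 -> 'rV[R]_k.-1) : Prop :=
  forall i j, dot ('d X x (w i)) ('d X x (w j)) = (i == j)%:R.

(* Levi-Civita connection of the sphere: D_e N at [X x], for e = dX_x(w), is the
   ambient derivative of [N] projected orthogonally to the position vector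
   [X x]. *)
Definition covariant (R : realType) (k : nat)
    (X N : 'rV[R]_k.-1 -> 'rV[R]_k.+1) (x w : 'rV[R]_k.-1) : 'rV[R]_k.+1 :=
  'd N x w - dot ('d N x w) (X x) *: X x.

Definition mean_curvature (R : realType) (k : nat)
    (X N : 'rV[R]_k.-1 -> 'rV[R]_k.+1) (x : 'rV[R]_k.-1)
    (w : 'I_k.-1 -> 'rV[R]_k.-1) : R :=
  (k.-1%:R)^-1 * \sum_(i < k.-1) dot (covariant X N x (w i)) ('d X x (w i)).

Definition minimal (R : realType) (k : nat) (M : hypersurface R k) : Prop :=
  forall (c : chart R M k.-1), atlas c ->
  let X := @imm R k M \o chart_inv c in
  forall (W : set 'rV[R]_k.-1) (N : 'rV[R]_k.-1 -> 'rV[R]_k.+1),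
    open W -> W `<=` chart_img c -> unit_normal_field X N W ->
  forall (x : 'rV[R]_k.-1) (w : 'I_k.-1 -> 'rV[R]_k.-1),
    W x -> orthonormal_frame X x w -> mean_curvature X N x w = 0.

(* Main.v *)
Require Import Defs.
From mathcomp Require Import all_boot all_order all_algebra.
From mathcomp Require Import all_classical all_reals all_analysis.
From mathcomp Require Import ring lra.
Import Order.TTheory GRing.Theory Num.Theory.
Import numFieldNormedType.Exports.
Local Open Scope classical_set_scope.
Local Open Scope ring_scope.

(* If neither a nor b lies on the boundary, then (a, b) is a local maximum of
   <X, Y> for local parametrizations X, Y of M1, M2 around a and b, because
   dist = acos <., .>, and s = <a, b> lies in ]-1, 1[. At first order, both
   tangent spaces are the orthogonal complement of span(a, b). At second order,
   let X and Y move simultaneously in a common tangent direction e_i: the second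
   variation <X'', b> + 2 <e_i, e_i> + <a, Y''> is nonpositive. Minimality gives
   sum_i <X'', b - s a> = 0 and |X| = 1 gives <X'', a> = -1, likewise for Y, so
   the sum over an orthonormal frame is 2 (k - 1) (1 - s) > 0. *)

(** * The Euclidean inner product *)

Section Dot.
Context {R : realType} {n : nat}.
Implicit Types (u v w : 'rV[R]_n) (x : R).

Lemma dotC u v : dot u v = dot v u.
Proof. by apply: eq_bigr => i _; rewrite mulrC. Qed.

Lemma dotDl u v w : dot (u + v) w = dot u w + dot v w.
Proof. by rewrite -big_split; apply: eq_bigr => i _; rewrite mxE mulrDl. Qed.

Lemma dotZl x u v : dot (x *: u) v = x * dot u v.
Proof. by rewrite /dot mulr_sumr; apply: eq_bigr => i _; rewrite mxE mulrA. Qed.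

Lemma dotNl u v : dot (- u) v = - dot u v.
Proof. by rewrite -scaleN1r dotZl mulN1r. Qed.

Lemma dotBl u v w : dot (u - v) w = dot u w - dot v w.
Proof. by rewrite dotDl dotNl. Qed.

Lemma dotDr u v w : dot w (u + v) = dot w u + dot w v.
Proof. by rewrite dotC dotDl !(dotC w). Qed.

Lemma dotZr x u v : dot u (x *: v) = x * dot u v.
Proof. by rewrite dotC dotZl dotC. Qed.

Lemma dotNr u v : dot u (- v) = - dot u v.
Proof. by rewrite dotC dotNl dotC. Qed.

Lemma dotBr u v w : dot w (u - v) = dot w u - dot w v.
Proof. by rewrite dotDr dotNr. Qed.

Lemma dot0l u : dot 0 u = 0.
Proof. by rewrite -(scale0r 0) dotZl mul0r. Qed.

Lemma dotE u v : dot u v = (u *m v^T) 0 0.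
Proof. by rewrite mxE; apply: eq_bigr => i _; rewrite mxE. Qed.

Lemma dot_ge0 u : 0 <= dot u u.
Proof. by apply: sumr_ge0 => i _; rewrite -expr2 sqr_ge0. Qed.

Lemma dot_eq0 u : (dot u u == 0) = (u == 0).
Proof.
apply/idP/eqP => [|->]; last by rewrite dot0l.
rewrite psumr_eq0; last by move=> i _; rewrite -expr2 sqr_ge0.
move=> /allP u0; apply/rowP => i; rewrite mxE.
by have /eqP := u0 i (mem_index_enum i); rewrite -expr2 => /eqP; rewrite sqrf_eq0 => /eqP.
Qed.

Lemma dot_gt0 u : (0 < dot u u) = (u != 0).
Proof. by rewrite lt_def dot_ge0 andbT dot_eq0. Qed.

(** The squared norm of <v,v> u - <u,v> v is <v,v> times the difference of the two sides. *)
Lemma cauchy_schwarz u v : dot u v ^+ 2 <= dot u u * dot v v.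
Proof.
have [->|v0] := eqVneq v 0; first by rewrite dotC !dot0l expr0n mulr0.
have vv : 0 < dot v v by rewrite dot_gt0.
have := dot_ge0 (dot v v *: u - dot u v *: v).
rewrite !(dotBl, dotBr, dotZl, dotZr) (dotC v u) => h.
rewrite -subr_ge0 -(pmulr_rge0 _ vv); apply: le_trans h _.
by rewrite le_eqVlt; apply/orP; left; apply/eqP; ring.
Qed.

Lemma enorm_ge0 u : 0 <= enorm u.
Proof. exact: sqrtr_ge0. Qed.

Lemma enormE u : enorm u ^+ 2 = dot u u.
Proof. by rewrite sqr_sqrtr ?dot_ge0. Qed.

Lemma continuous_enorm : continuous (@enorm R n).
Proof.
have dotc : continuous (fun u : 'rV[R]_n => dot u u).
  apply: continuous_big => [|i _ u]; first exact: add_continuous.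
  by apply: (@cvgM _ _ (nbhs u)); exact: (@coord_continuous R 1 n 0 i u).
by move=> u; exact: (continuous_comp (dotc u) (@sqrt_continuous R _)).
Qed.

Lemma dot_unit_bound u v : dot u u = 1 -> dot v v = 1 -> -1 <= dot u v <= 1.
Proof.
move=> hu hv; have := cauchy_schwarz u v; rewrite hu hv mulr1 => h.
by apply/andP; split; nra.
Qed.

Lemma dot_eq1 u v : dot u u = 1 -> dot v v = 1 -> dot u v = 1 -> u = v.
Proof.
move=> hu hv huv; apply/eqP; rewrite -subr_eq0 -dot_eq0.
by rewrite !(dotBl, dotBr) (dotC v u) hu hv huv !subrr.
Qed.

End Dot.

Lemma is_derive_coord {R : realType} {V : normedModType R} {m n : nat}
    (f : V -> 'M[R]_(m, n)) x v df i j :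
  is_derive x v f df -> is_derive x v (fun y => f y i j) (df i j).
Proof.
move=> [dv <-]; apply: DeriveDef; first by move/derivable_mxP : dv; exact.
by rewrite derive_mx// mxE.
Qed.

Lemma is_derive_dot {R : realType} {V : normedModType R} {n : nat}
    (f g : V -> 'rV[R]_n) x v df dg :
  is_derive x v f df -> is_derive x v g dg ->
  is_derive x v (fun y => dot (f y) (g y)) (dot df (g x) + dot (f x) dg).
Proof.
move=> hf hg.
pose h (i : 'I_n) (y : V) := f y 0 i * g y 0 i.
rewrite (_ : (fun y => _) = \sum_(i < n) h i); last first.
  by apply/funext => y; rewrite fct_sumE.
rewrite (_ : _ + _ = \sum_(i < n) (df 0 i * g x 0 i + f x 0 i * dg 0 i)); last first.
  by rewrite big_split.
apply: is_derive_sum => i.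
apply: is_derive_eq.
  by apply: is_deriveM; apply: is_derive_coord.
by rewrite /GRing.scale/= addrC mulrC.
Qed.

Lemma is_derive_scalel {R : realType} {V : normedModType R} (g : R -> R) (w : V)
    (t dg : R) :
  is_derive t 1 g dg -> is_derive t 1 (fun s => g s *: w) (dg *: w).
Proof.
move=> [/derivable1_diffP dgt <-].
have dgw := differentiableZl w dgt.
by apply: DeriveDef; [exact/derivable1_diffP|rewrite !deriveE// diffZl].
Qed.

(** * The geodesic distance of the sphere *)

Section GeodesicDistance.
Context {R : realType} {k : nat}.
Implicit Types (t : R) (p q : 'rV[R]_k.+1) (c : R -> 'rV[R]_k.+1).
Notation mu := (@lebesgue_measure R).

(** A curve is only required to stay on the sphere over [0, 1], so |c|^2 is known to be locally
    constant at interior times only. *)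
Lemma sphere_curve_orthogonal c p q t : sphere_curve c p q -> t \in `]0, 1[ ->
  dot (c^`()%classic t) (c t) = 0.
Proof.
move=> [dc _ sc _ _] t01.
have dct : is_derive t 1 c (c^`()%classic t) by rewrite derive1E; apply/derivableP/dc.
have d1 := is_derive_dot _ _ _ _ _ _ dct dct.
have d2 : is_derive t 1 (fun s => dot (c s) (c s)) 0.
  apply: (@near_eq_is_derive R R R (cst 1) (fun s => dot (c s) (c s)) t 1 0 _
    (is_derive_cst _ _ _)).
  near=> s; rewrite sc//; have : s \in `]0, 1[ by near: s; apply: near_in_itvoo.
  by rewrite in_itv/= => /andP[/ltW -> /ltW ->].
have := @derive_val _ _ _ _ _ _ _ d1; rewrite (@derive_val _ _ _ _ _ _ _ d2).
by rewrite (dotC (c t)) => h; lra.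
Unshelve. all: by end_near. Qed.

Lemma acos_le (x y : R) : -1 <= x <= 1 -> -1 <= y <= 1 -> x <= y -> acos y <= acos x.
Proof.
move=> hx hy xy; rewrite leNgt; apply/negP => h.
have := @ltr_cos R (acos x) (acos y).
rewrite !in_itv/= !acos_ge0 ?acos_lepi// => /(_ isT isT).
by rewrite !acosK ?in_itv//= h ltNge xy.
Qed.

(* The factor lam < 1 keeps lam <c, p> away from the points -1 and 1, where acos
   is not differentiable; acos (lam <c, p>) is then |c'|-Lipschitz by
   Cauchy-Schwarz applied to c' and p - <c, p> c, since c' is orthogonal to c. *)
Lemma acos_curve_le c p q (lam : R) : sphere p -> 0 < lam < 1 ->
  sphere_curve c p q -> acos (lam * dot q p) - acos lam <= curve_length c.
Proof.
move=> hp /andP[l0 l1] sc; have [dc cdc sph c0 c1] := sc.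
pose sp t : R := enorm (c^`()%classic t).
have csp : continuous sp by move=> t; exact: (continuous_comp (cdc t) (continuous_enorm _)).
have isp a b : mu.-integrable `[a, b] (EFin \o sp).
  apply: continuous_compact_integrable; first exact: segment_compact.
  exact: continuous_subspaceT.
(* [G] is the arc length from time 0. The estimate follows once [G - phi] is shown to be
   nondecreasing, where [phi] is the angle to [p] damped by [lam]. *)
pose G t : R := parameterized_integral mu 0 t sp.
have cG : {within `[0, 1], continuous G}.
  by apply: parameterized_integral_continuous => //; exact: isp.
have dG t : t \in `]0, 1[ -> is_derive t 1 G (sp t).
  rewrite in_itv => /andP[t0 t1].
  have [dGt Gt] := @continuous_FTC1_closed R sp 0 t 1 t1 (isp 0 1) t0 (csp t).
  by apply: DeriveDef => //; rewrite -derive1E.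
pose f t := dot (c t) p.
have f1 t : 0 <= t <= 1 -> -1 <= f t <= 1.
  by move=> /sph ct; exact: dot_unit_bound.
have lf t : 0 <= t <= 1 -> -1 < lam * f t < 1.
  by move=> /f1 /andP[h1 h2]; apply/andP; split; nra.
pose phi t := acos (lam * f t).
pose dphi t := - (Num.sqrt (1 - (lam * f t) ^+ 2))^-1 *
  (lam * dot (c^`()%classic t) p).
have dphiP t : 0 <= t <= 1 -> is_derive t 1 phi (dphi t).
  move=> t01.
  have dct : is_derive t 1 c (c^`()%classic t) by rewrite derive1E; apply/derivableP/dc.
  have df : is_derive t 1 f (dot (c^`()%classic t) p).
    apply: is_derive_eq (is_derive_dot _ _ _ _ _ _ dct (is_derive_cst p t 1)) _.
    by rewrite (dotC (c t)) dot0l addr0.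
  apply: (@is_derive1_comp _ (@acos R) (fun t => lam * f t)).
    exact/is_derive1_acos/lf.
have cphi : {within `[0, 1], continuous phi}.
  apply: derivable_within_continuous => t; rewrite in_itv/= => t01.
  by apply: ex_derive; exact: dphiP.
have oc t : t \in `]0, 1[ -> 0 <= t <= 1.
  by rewrite in_itv/= => /andP[/ltW -> /ltW ->].
have dD t : t \in `]0, 1[ -> is_derive t 1 (G - phi) (sp t - dphi t).
  by move=> t01; apply: is_deriveB; [exact: dG|exact/dphiP/oc].
have : G 0 - phi 0 <= G 1 - phi 1.
  apply: (@ger0_derive1_le_cc R (G - phi) 0 1); rewrite ?in_itv/= ?lexx ?ler01//.
  - by move=> t /dD h; apply: ex_derive.
  - move=> t t01; rewrite derive1E (@derive_val _ _ _ _ _ _ _ (dD t t01)).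
    have /andP[g1 g2] := lf t (oc t t01).
    have ortho := sphere_curve_orthogonal c p q t sc t01.
    have st : dot (c t) (c t) = 1 by apply: sph; exact: oc.
    rewrite /dphi mulNr opprK.
    set s := Num.sqrt _.
    have s0 : 0 < s by rewrite sqrtr_gt0; nra.
    have s2 : s ^+ 2 = 1 - (lam * f t) ^+ 2 by rewrite sqr_sqrtr//; nra.
    have v0 : 0 <= sp t by exact: enorm_ge0.
    have := cauchy_schwarz (c^`()%classic t) (p - f t *: c t).
    rewrite -enormE -/(sp t) !(dotBl, dotBr, dotZl, dotZr) ortho mulr0 subr0 st.
    rewrite (dotC p) -/(f t) (hp : dot p p = 1).
    set d := dot _ p => h.
    have h2 : (lam * d) ^+ 2 <= (sp t * s) ^+ 2.
      rewrite exprMn exprMn s2.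
      (* Cauchy-Schwarz gives the factor lam^2 (1 - f^2), which is at most s^2 = 1 - (lam f)^2
         because lam^2 <= 1. *)
      apply: (@le_trans _ _ (lam ^+ 2 * (sp t ^+ 2 * (1 - f t ^+ 2)))).
        rewrite ler_pM2l ?exprn_gt0// (le_trans h)//.
        by rewrite le_eqVlt; apply/orP; left; apply/eqP; ring.
      rewrite mulrCA ler_wpM2l ?sqr_ge0//; nra.
    have h3 : `|lam * d| <= sp t * s.
      by rewrite -(@ler_pXn2r _ 2)// ?nnegrE ?mulr_ge0 ?(ltW s0)// real_normK ?num_real.
    have := le_trans (ler_norm (- (lam * d))) _; rewrite normrN => /(_ _ h3) h4.
    rewrite (_ : sp t + _ = (sp t * s + lam * d) / s); last by field; rewrite gt_eqF.
    by rewrite divr_ge0 ?(ltW s0)//; lra.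
  - by move=> t; apply: continuousB; [exact: cG|exact: cphi].
(* [G 0] is an integral over a single point, and [phi 0] is [acos lam] because [c] starts at [p]. *)
rewrite {1}/G /parameterized_integral set_itv1 Rintegral_set1 /phi /f c0 c1.
rewrite (hp : dot p p = 1) mulr1 sub0r.
by rewrite -/(curve_length c) /G /parameterized_integral -/(curve_length c); lra.
Qed.

(* Let lam = cos d tend to 1 in [acos_curve_le]. *)
Lemma acos_le_curve_length c p q : sphere p -> sphere q -> sphere_curve c p q ->
  acos (dot p q) <= curve_length c.
Proof.
move=> hp hq sc; have pq := dot_unit_bound _ _ hp hq.
have L0 : 0 <= curve_length c by apply: Rintegral_ge0 => t _; exact: enorm_ge0.
set L := curve_length c in L0 *; rewrite leNgt; apply/negP => lt_L.
have Lpi : L < pi by rewrite (lt_le_trans lt_L)// acos_lepi.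
suff : cos L <= dot p q.
  have Li : L \in `[0, pi] by rewrite in_itv/= L0 ltW.
  have Ai : acos (dot p q) \in `[0, pi] by rewrite in_itv/= acos_ge0 ?acos_lepi.
  by rewrite -(acosK pq) leNgt ltr_cos// lt_L.
(* <p,q> - cos L is the value at d = 0 of cos d <p,q> - cos (L + d), so nonnegativity for small d >
   0 is enough. *)
rewrite -subr_ge0 -[X in X - _]mul1r -{1}(@cos0 R) -[L]addr0.
have cvgh : cos d * dot p q - cos (L + d) @[d --> 0^'+] --> cos 0 * dot p q - cos (L + 0).
  apply: cvg_at_right_filter; apply: cvgB.
    by apply: cvgMr_tmp; exact: continuous_cos.
  apply: (@continuous_comp _ _ _ (fun d => L + d) cos); last exact: continuous_cos.
  by apply: cvgD; [exact: cvg_cst|exact: cvg_id].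
apply: cvgr_to_ge cvgh _.
have pi2 : 0 < pi / 2 :> R by rewrite divr_gt0// pi_gt0.
near=> d.
have d0 : 0 < d by [].
have dpi2 : d < pi / 2 by near: d; exact: nbhs_right_lt.
(* Because L < pi, the angle [L + d] stays in [0, pi], where the cosine is decreasing. *)
have Ld : L + d < pi by rewrite -ltrBrDl; near: d; apply: nbhs_right_lt; rewrite subr_gt0.
have di : d \in `[0, pi] by rewrite in_itv/=; apply/andP; split; lra.
have lam0 : 0 < cos d by apply: cos_gt0_pihalf; apply/andP; split; lra.
have lam1 : cos d < 1.
  rewrite -(@cos0 R) ltr_cos// in_itv/= lexx; lra.
have := acos_curve_le c p q (cos d) hp _ sc; rewrite lam0 lam1 => /(_ isT).
rewrite cosK// (dotC q) -/L => h.
have lpq : -1 <= cos d * dot p q <= 1 by case/andP: pq => *; apply/andP; split; nra.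
rewrite subr_ge0 -[leRHS](acosK lpq) leNgt ltr_cos ?in_itv/= ?acos_ge0 ?acos_lepi//.
  by rewrite -leNgt; lra.
by apply/andP; split; lra.
Unshelve. all: by end_near. Qed.

(** The parametrization over [0, 1] has constant speed |th|, which is its length. *)
Lemma great_circle p u (th : R) : sphere p -> sphere u -> dot p u = 0 -> 0 <= th ->
  exists2 c, sphere_curve c p (cos th *: p + sin th *: u) & curve_length c = th.
Proof.
move=> hp hu pu th0.
pose c (t : R) := cos (th * t) *: p + sin (th * t) *: u.
pose dc (t : R) := (- sin (th * t) * th) *: p + (cos (th * t) * th) *: u.
have dth t : is_derive t 1 (fun t : R => th * t) th.
  by apply: is_derive_eq (@is_deriveZ R R R id th t 1 1 (is_derive_id _ _)) (mulr1 th).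
have dcE t : is_derive t 1 c (dc t).
  have dcos : is_derive t 1 (fun t => cos (th * t)) (- sin (th * t) * th).
    exact: (@is_derive1_comp _ cos (fun t => th * t)).
  have dsin : is_derive t 1 (fun t => sin (th * t)) (cos (th * t) * th).
    exact: (@is_derive1_comp _ sin (fun t => th * t)).
  exact: is_deriveD (is_derive_scalel _ p _ _ dcos) (is_derive_scalel _ u _ _ dsin).
have dcE1 : (c^`())%classic = dc.
  by apply/funext => t; rewrite derive1E (@derive_val _ _ _ _ _ _ _ (dcE t)).
have norm2 (a b : R) : dot (a *: p + b *: u) (a *: p + b *: u) = a ^+ 2 + b ^+ 2.
  rewrite !(dotDl, dotDr, dotZl, dotZr) (dotC u) pu (hp : dot p p = 1) (hu : dot u u = 1).
  ring.
exists c.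
  split.
  - by move=> t; apply: ex_derive.
  - rewrite dcE1; have cth : continuous (fun t : R => th * t).
      by move=> t; apply: differentiable_continuous; apply/derivable1_diffP; apply: ex_derive.
    have ccos t : {for t, continuous (fun t => cos (th * t))}.
      exact: (continuous_comp (cth t) (@continuous_cos R _)).
    have csin t : {for t, continuous (fun t => sin (th * t))}.
      exact: (continuous_comp (cth t) (@continuous_sin R _)).
    move=> t; apply: cvgD; apply: cvgZr_tmp; apply: cvgMr_tmp.
      by apply: cvgN; exact: csin.
    exact: ccos.
  - by move=> t _; rewrite /sphere/= norm2 cos2Dsin2.
  - by rewrite /c mulr0 cos0 sin0 scale1r scale0r addr0.
  - by rewrite /c mulr1.
rewrite /curve_length dcE1.
rewrite (_ : (fun t => enorm (dc t)) = cst th); last first.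
  apply/funext => t /=; rewrite /enorm norm2 !exprMn sqrrN -mulrDl addrC cos2Dsin2 mul1r.
  by rewrite sqrtr_sqr ger0_norm.
have mu01 : mu [set` `[0, 1]%R] = 1%E.
  by rewrite lebesgue_measure_itv/= lte_fin ltr01 oppr0 adde0.
by rewrite Rintegral_cst//= [X in fine X]mu01 mulr1.
Qed.

(** The first two coordinates of [p], rotated by a quarter turn and completed by zeros, form a
    vector orthogonal to [p]. If it vanishes, so does the first coordinate of [p], and the first
    basis vector serves. *)
Lemma unit_orthogonal p : sphere p -> (0 < k)%N -> exists2 u, sphere u & dot p u = 0.
Proof.
case: k p => // m p hp _.
pose i1 : 'I_m.+2 := lift ord0 ord0.
pose w : 'rV[R]_m.+2 :=
  \row_j if j == ord0 then - p 0 i1 else if j == i1 then p 0 ord0 else 0.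
have dotw v : dot v w = v 0 i1 * p 0 ord0 - v 0 ord0 * p 0 i1.
  rewrite /dot (bigD1 ord0)//= (bigD1 i1)//= big1 ?addr0; last first.
    by move=> i /andP[/negPf i0 /negPf i1']; rewrite mxE i0 i1' mulr0.
  by rewrite !mxE/= mulrN addrC.
have pw : dot p w = 0 by rewrite dotw mulrC subrr.
have [w0|w0] := eqVneq w 0.
  pose e : 'rV[R]_m.+2 := delta_mx 0 ord0; exists e.
    rewrite /sphere/= /dot (bigD1 ord0)//= big1 ?addr0 ?mxE ?mulr1// => i /negPf i0.
    by rewrite mxE i0 mulr0.
  have p0 : p 0 ord0 = 0.
    by move/rowP : w0 => /(_ i1); rewrite !mxE.
  rewrite /dot (bigD1 ord0)//= big1 ?addr0 ?p0 ?mul0r// => i /negPf i0.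
  by rewrite mxE i0 andbF mulr0.
have ww : 0 < dot w w by rewrite dot_gt0.
exists ((enorm w)^-1 *: w); last by rewrite dotZr pw mulr0.
rewrite /sphere/= dotZl dotZr mulrA -expr2 exprVn enormE mulVf// gt_eqF//.
Qed.

(** [u] is the normalized component of [q] orthogonal to [p]. When the sine vanishes, [q] is [p] or
    its antipode and any unit vector orthogonal to [p] serves. *)
Lemma great_circleP p q : (0 < k)%N -> sphere p -> sphere q ->
  exists2 c, sphere_curve c p q & curve_length c = acos (dot p q).
Proof.
move=> k0 hp hq; have pq := dot_unit_bound _ _ hp hq.
set th := acos (dot p q).
have th0 : 0 <= th by rewrite acos_ge0.
have cth : cos th = dot p q by rewrite acosK// in_itv.
suff [u hu [pu ->]] : exists2 u, sphere u & dot p u = 0 /\ q = cos th *: p + sin th *: u.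
  exact: great_circle.
have [s0|s0] := eqVneq (sin th) 0.
  have [u hu pu] := unit_orthogonal p hp k0.
  exists u => //; split => //; rewrite s0 scale0r addr0; apply/eqP.
  rewrite -subr_eq0 -dot_eq0 !(dotBl, dotBr, dotZl, dotZr) (dotC q) -cth.
  rewrite (hp : dot p p = 1) (hq : dot q q = 1).
  have := cos2Dsin2 th; rewrite s0 => h; apply/eqP; nra.
have s2 : sin th ^+ 2 = 1 - dot p q ^+ 2 by rewrite -cth -(cos2Dsin2 th); ring.
exists ((sin th)^-1 *: (q - dot p q *: p)).
  rewrite /sphere/= dotZl dotZr mulrA -expr2 !(dotBl, dotBr, dotZl, dotZr) (dotC q).
  rewrite (hp : dot p p = 1) (hq : dot q q = 1) exprVn.
  rewrite (_ : _ - _ - _ = sin th ^+ 2) ?mulVf ?expf_neq0//; rewrite s2; ring.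
split; first by rewrite dotZr dotBr dotZr (hp : dot p p = 1) mulr1 subrr mulr0.
by rewrite scalerA divff// scale1r cth addrC subrK.
Qed.

(** The lower bound on lengths is attained by an arc of great circle. The case k = 0 is excluded
    because no curve joins the two points of S^0. *)
Lemma geodistE p q : (0 < k)%N -> sphere p -> sphere q ->
  geodist p q = acos (dot p q).
Proof.
move=> k0 hp hq; have [c sc cl] := great_circleP p q k0 hp hq.
have lb : lbound [set curve_length c | c in [set c | sphere_curve c p q]] (acos (dot p q)).
  by move=> _ [d sd <-]; exact: acos_le_curve_length.
apply/eqP; rewrite eq_le; apply/andP; split.
  by apply: ge_inf; [exists (acos (dot p q))|exists c].
by apply: lb_le_inf => //; exists (curve_length c), c.
Qed.

End GeodesicDistance.

(** * Minimal parametrizations *)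

Section Differentiability.
Context {R : realType} {V : normedModType R}.

Lemma differentiable_big_sum {I : Type} (r : seq I) (F : I -> V -> R) x :
  (forall i, differentiable (F i) x) ->
  differentiable (fun y => \sum_(i <- r) F i y) x.
Proof.
move=> dF; elim: r => [|i r IH].
  by under eq_fun do rewrite big_nil; exact: differentiable_cst.
by under eq_fun do rewrite big_cons; exact: differentiableD.
Qed.

Lemma differentiable_big_prod {I : Type} (r : seq I) (F : I -> V -> R) x :
  (forall i, differentiable (F i) x) ->
  differentiable (fun y => \prod_(i <- r) F i y) x.
Proof.
move=> dF; elim: r => [|i r IH].
  by under eq_fun do rewrite big_nil; exact: differentiable_cst.
by under eq_fun do rewrite big_cons; exact: differentiableM.
Qed.

Lemma differentiable_entry {m n : nat} (F : V -> 'M[R]_(m, n)) x i j :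
  differentiable F x -> differentiable (fun y => F y i j) x.
Proof.
move=> dF; apply: (@differentiable_comp _ _ _ _ F (fun M : 'M[R]_(m, n) => M i j)) => //.
exact: differentiable_coord.
Qed.

Lemma differentiable_mx {m n : nat} (F : V -> 'M[R]_(m, n)) x :
  (forall i j, differentiable (fun y => F y i j) x) -> differentiable F x.
Proof.
move=> dF.
pose h i (y : V) : 'M[R]_(m, n) := \sum_(j < n) F y i j *: delta_mx i j.
have -> : F = \sum_(i < m) h i.
  by apply/funext => y; rewrite fct_sumE {1}(matrix_sum_delta (F y)).
apply: differentiable_sum => i.
have -> : h i = \sum_(j < n) (fun y : V => F y i j *: delta_mx i j).
  by apply/funext => y; rewrite fct_sumE.
by apply: differentiable_sum => j; exact: differentiableZl.
Qed.

Lemma differentiable_det {n : nat} (F : V -> 'M[R]_n) x :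
  (forall i j, differentiable (fun y => F y i j) x) ->
  differentiable (fun y => \det (F y)) x.
Proof.
move=> dF; apply: differentiable_big_sum => s.
apply: differentiableM; first exact: differentiable_cst.
exact: differentiable_big_prod.
Qed.

Lemma differentiable_dot {n : nat} (F G : V -> 'rV[R]_n) x :
  differentiable F x -> differentiable G x ->
  differentiable (fun y => dot (F y) (G y)) x.
Proof.
move=> dF dG; apply: differentiable_big_sum => i.
by apply: differentiableM; exact: differentiable_entry.
Qed.

Lemma differentiable_scale {n : nat} (g : V -> R) (F : V -> 'rV[R]_n) x :
  differentiable g x -> differentiable F x ->
  differentiable (fun y => g y *: F y) x.
Proof.
move=> dg dF; apply: differentiable_mx => i j.
under eq_fun do rewrite mxE.
by apply: differentiableM => //; exact: differentiable_entry.
Qed.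

Lemma differentiable_enormV {n : nat} (F : V -> 'rV[R]_n) x :
  differentiable F x -> F x != 0 -> differentiable (fun y => (enorm (F y))^-1) x.
Proof.
move=> dF F0; have pos : 0 < dot (F x) (F x) by rewrite dot_gt0.
apply: differentiableV; last by rewrite sqrtr_eq0 -ltNge.
apply: (@differentiable_comp _ _ _ _ (fun y => dot (F y) (F y)) Num.sqrt).
  exact: differentiable_dot.
by apply/derivable1_diffP; apply: ex_derive; exact: is_derive1_sqrt.
Qed.

End Differentiability.

(** * The generalized cross product *)

Section CrossProduct.
Context {R : realType} {n : nat}.
Implicit Types (v x : 'rV[R]_n.+2) (J : 'M[R]_(n, n.+2)).

(** The rows are [v], [x], then those of [J]. Indexing by [unlift] fits the deletion of row [ord0]
    in a cofactor. *)
Definition stack v x J : 'M[R]_n.+2 :=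
  \matrix_(i, j) if unlift ord0 i is Some i1 then
    if unlift ord0 i1 is Some l then J l j else x 0 j else v 0 j.

(** This is the cross product of the n + 1 vectors formed by [x] and the rows of [J]. The first row
    of [stack] is a placeholder, invisible to the cofactors along it. *)
Definition cross x J : 'rV[R]_n.+2 := \row_j cofactor (stack 0 x J) ord0 j.

Lemma stack0 v x J j : stack v x J ord0 j = v 0 j.
Proof. by rewrite mxE unlift_none. Qed.

Lemma stack1 v x J j : stack v x J (lift ord0 ord0) j = x 0 j.
Proof. by rewrite mxE liftK unlift_none. Qed.

Lemma stackS v x J i j : stack v x J (lift ord0 (lift ord0 i)) j = J i j.
Proof. by rewrite mxE !liftK. Qed.

(** Laplace expansion along the first row. Orthogonality to [x] and to the rows of [J] then comes
    from determinants with two equal rows. *)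
Lemma dot_cross v x J : dot v (cross x J) = \det (stack v x J).
Proof.
rewrite (expand_det_row _ ord0); apply: eq_bigr => j _.
rewrite mxE stack0; congr (_ * (_ * \det _)).
by apply/matrixP => a b; rewrite !mxE liftK.
Qed.

Lemma cross_orthogonal_pos x J : dot x (cross x J) = 0.
Proof.
rewrite dot_cross; apply: (@determinant_alternate _ _ _ ord0 (lift ord0 ord0)) => // j.
by rewrite stack0 stack1.
Qed.

Lemma cross_orthogonal_row x J i : dot (row i J) (cross x J) = 0.
Proof.
rewrite dot_cross.
apply: (@determinant_alternate _ _ _ ord0 (lift ord0 (lift ord0 i))) => // j.
by rewrite stack0 stackS mxE.
Qed.

(** The vectors [v], [x] and the rows of [J] form a basis, so [stack v x J] is invertible, and
    [cross x J] and [c *: v] have the same inner product with each of them. *)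
Lemma cross_collinear v x J :
  v != 0 -> dot v x = 0 -> (forall w : 'rV_n, dot v (w *m J) = 0) ->
  dot x x = 1 -> (forall w : 'rV_n, dot x (w *m J) = 0) -> row_free J ->
  exists2 c : R, c != 0 & cross x J = c *: v.
Proof.
move=> v0 vx vJ xx xJ Jfree.
have vv : dot v v != 0 by rewrite dot_eq0.
have unitB : stack v x J \in unitmx.
  rewrite -row_free_unit; apply: inj_row_free => u uB.
  pose u2 : 'rV_n := \row_i u 0 (lift ord0 (lift ord0 i)).
  have uBE : u 0 ord0 *: v + u 0 (lift ord0 ord0) *: x + u2 *m J = 0.
    rewrite -uB; apply/rowP => j; rewrite !mxE !big_ord_recl stack0 stack1 addrA.
    by congr (_ + _); apply: eq_bigr => i _; rewrite stackS mxE.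
  have := congr1 (dot v) uBE; rewrite !dotDr !dotZr vx vJ mulr0 !addr0 dotC dot0l.
  move/eqP; rewrite mulf_eq0 (negPf vv) orbF => /eqP u0.
  have := congr1 (dot x) uBE.
  rewrite !dotDr !dotZr (dotC x v) vx xJ xx mulr0 addr0 add0r mulr1 dotC dot0l.
  move=> u1; move: uBE; rewrite u0 u1 !scale0r !add0r => u2J.
  have u20 : u2 = 0 by apply: (row_free_inj Jfree); rewrite u2J mul0mx.
  apply/rowP => i; rewrite mxE; case: (unliftP ord0 i) => [i1|] ->//.
  case: (unliftP ord0 i1) => [l|] ->//.
  by move/rowP : u20 => /(_ l); rewrite !mxE.
(* Forced by <v, c v> = <v, cross x J>, whose right-hand side is the determinant. *)
pose c := \det (stack v x J) / dot v v.
exists c.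
  by rewrite mulf_neq0 ?invr_neq0// -unitfE -unitmxE.
apply/eqP; rewrite -subr_eq0 -trmx_eq0; apply/eqP.
apply: (can_inj (mulKmx unitB)); rewrite mulmx0; apply/colP => i.
have -> : (stack v x J *m (cross x J - c *: v)^T) i 0 =
    dot (row i (stack v x J)) (cross x J - c *: v).
  by rewrite mxE; apply: eq_bigr => j _; rewrite !mxE.
rewrite mxE dotBr dotZr; case: (unliftP ord0 i) => [i1|] ->; last first.
  have -> : row ord0 (stack v x J) = v by apply/rowP => j; rewrite mxE stack0.
  by rewrite dot_cross /c divfK// subrr.
case: (unliftP ord0 i1) => [l|] ->; last first.
  have -> : row (lift ord0 ord0) (stack v x J) = x by apply/rowP => j; rewrite mxE stack1.
  by rewrite cross_orthogonal_pos dotC vx mulr0 subrr.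
have -> : row (lift ord0 (lift ord0 l)) (stack v x J) = row l J.
  by apply/rowP => j; rewrite mxE stackS mxE.
by rewrite cross_orthogonal_row rowE dotC vJ mulr0 subrr.
Qed.

End CrossProduct.

(** Up to sign, each coordinate is a minor, hence a polynomial in the entries of [F] and [J]. *)
Lemma differentiable_cross {R : realType} {V : normedModType R} {n : nat}
    (F : V -> 'rV[R]_n.+2) (J : V -> 'M[R]_(n, n.+2)) x :
  differentiable F x -> differentiable J x ->
  differentiable (fun y => cross (F y) (J y)) x.
Proof.
move=> dF dJ; apply: differentiable_mx => i j.
under eq_fun do rewrite mxE.
apply: differentiableM; first exact: differentiable_cst.
apply: differentiable_det => a b.
under eq_fun do rewrite !mxE liftK.
case: unliftP => [c _|_].
  exact: differentiable_entry.
exact: differentiable_entry.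
Qed.

(** * Minimality as a vanishing trace *)

Section MinimalTrace.
Context {R : realType} {n : nat}.
Implicit Types (X N : 'rV[R]_n -> 'rV[R]_n.+2) (U W : set 'rV[R]_n).

(** The condition in [minimal] for one parametrization, detached from the atlas so that [U] can be
    shrunk at will. *)
Definition minimal_param X U :=
  forall W N, open W -> W `<=` U -> @unit_normal_field R n.+1 X N W ->
  forall x (w : 'I_n -> 'rV[R]_n),
    W x -> @orthonormal_frame R n.+1 X x w -> @mean_curvature R n.+1 X N x w = 0.

Lemma sphere_param_tangent X x w : (forall y, sphere (X y)) -> differentiable X x ->
  dot (X x) ('d X x w) = 0.
Proof.
move=> sX dX; rewrite -deriveE//.
have dXw : is_derive x w X ('D_w X x) by apply/derivableP; exact: diff_derivable.
have := @derive_val _ _ _ _ _ _ _ (is_derive_dot _ _ _ _ _ _ dXw dXw).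
rewrite (_ : (fun y => _) = cst 1); last by apply/funext => y; exact: sX.
by rewrite derive_cst (dotC ('D_w X x)) => h; lra.
Qed.

(* The generalized cross product of X and its partial derivatives is a
   differentiable normal field near x, collinear to v at x. Differentiating
   <N, 'D_w X> = 0 along w turns the mean curvature into the trace of
   -<N, X''>. *)
Lemma minimal_trace X U x v (w : 'I_n -> 'rV[R]_n) :
  (0 < n)%N -> open U -> U x -> (forall y, sphere (X y)) -> Cn_on 2 U X ->
  injective ('d X x) -> minimal_param X U ->
  v != 0 -> dot v (X x) = 0 -> (forall u, dot v ('d X x u) = 0) ->
  @orthonormal_frame R n.+1 X x w ->
  \sum_(i < n) dot v ('D_(w i) ('D_(w i) X) x) = 0.
Proof.
move=> n0 oU Ux sX [dX dDX] injX minX v0 vX vdX frw.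
have {}dDX u y : U y -> differentiable ('D_u X) y by move=> Uy; apply: (dDX u).1.
pose J y : 'M[R]_(n, n.+2) := \matrix_(i, j) 'D_(delta_mx 0 i) X y 0 j.
have dJE y u : U y -> u *m J y = 'd X y u.
  move=> Uy; rewrite [in RHS](row_sum_delta u) linear_sum mulmx_sum_row.
  apply: eq_bigr => i _; rewrite linearZ; congr (_ *: _).
  by rewrite -deriveE; [apply/rowP => j; rewrite !mxE|exact: dX].
pose m y := cross (X y) (J y).
have dm y : U y -> differentiable m y.
  move=> Uy; apply: differentiable_cross; first exact: dX.
  apply: differentiable_mx => i j; under eq_fun do rewrite mxE.
  by apply: differentiable_entry; exact: dDX.
have [c c0 mx] : exists2 c : R, c != 0 & m x = c *: v.
  apply: cross_collinear => //; last first.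
    apply: inj_row_free => u; rewrite dJE// => u0; apply: injX; rewrite u0 linear0//.
  - by move=> u; rewrite dJE// (sphere_param_tangent X x u sX (dX x Ux)).
  - exact: sX.
  - by move=> u; rewrite dJE.
have mx0 : m x != 0 by rewrite mx scaler_eq0 negb_or c0.
(* Normalizing [m] requires it to be nonzero, which holds at [x] and, by continuity, near [x]. *)
pose W := (U `&` [set y | m y != 0])^°.
have WU : W `<=` U by move=> y /interior_subset[].
have Wm y : W y -> m y != 0 by move=> /interior_subset[].
have oW : open W by exact: open_interior.
have Wx : W x.
  apply: filterI; first exact: open_nbhs_nbhs.
  have /differentiable_continuous cm := dm x Ux.
  exact: (cvgr_neq0 _ cm).
pose N y := (enorm (m y))^-1 *: m y.
have dN y : W y -> differentiable N y.
  move=> Wy; have dmy := dm y (WU y Wy); apply: differentiable_scale => //.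
  by apply: differentiable_enormV => //; exact: Wm.
have mX y : dot (m y) (X y) = 0 by rewrite dotC cross_orthogonal_pos.
have mdX y u : U y -> dot (m y) ('d X y u) = 0.
  move=> Uy; rewrite -dJE// mulmx_sum_row dotC /dot.
  under eq_bigr do rewrite summxE mulr_suml.
  rewrite exchange_big big1// => i _.
  have := cross_orthogonal_row (X y) (J y) i; rewrite /dot => h.
  by under eq_bigr do rewrite mxE -mulrA; rewrite -mulr_sumr h mulr0.
have NdX y u : U y -> dot (N y) ('d X y u) = 0.
  by move=> Uy; rewrite dotZl mdX// mulr0.
have normalN : @unit_normal_field R n.+1 X N W.
  move=> y Wy; split.
  - exact: dN.
  - rewrite dotZl dotZr mulrA -expr2 exprVn enormE mulVf//.
    by rewrite dot_eq0; exact: Wm.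
  - by rewrite dotZl mX mulr0.
  - by move=> u; apply: NdX; exact: WU.
have := minX W N oW WU normalN x w Wx frw.
rewrite /mean_curvature/= => /eqP; rewrite mulf_eq0 invr_eq0 pnatr_eq0 -leqn0 leqNgt n0/=.
have ND i : dot (covariant (k := n.+1) X N x (w i)) ('d X x (w i)) =
    - ((enorm (m x))^-1 * c) * dot v ('D_(w i) ('D_(w i) X) x).
  (* The projection term of [covariant] is a multiple of [X x], orthogonal to the tangent vector. *)
  rewrite /covariant dotBl dotZl (sphere_param_tangent X x (w i) sX (dX x Ux)) mulr0 subr0.
  have dNw : is_derive x (w i) N ('D_(w i) N x).
    by apply/derivableP; apply: diff_derivable; exact: dN.
  have dXw : is_derive x (w i) ('D_(w i) X) ('D_(w i) ('D_(w i) X) x).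
    by apply/derivableP; apply: diff_derivable; exact: dDX.
  have := @derive_val _ _ _ _ _ _ _ (is_derive_dot _ _ _ _ _ _ dNw dXw).
  rewrite (@near_eq_derive R _ _ _ (cst 0)); last first.
    near=> y; have Uy : U y by near: y; apply: open_nbhs_nbhs.
    by rewrite deriveE ?NdX//; exact: dX.
  rewrite derive_cst (deriveE _ (dN x Wx)) (deriveE _ (dX x Ux)).
  by rewrite {2}/N mx scalerA dotZl => h; lra.
under eq_bigr do rewrite ND.
rewrite -mulr_sumr mulf_eq0 oppr_eq0 mulf_eq0 invr_eq0 (negPf c0) orbF sqrtr_eq0.
by rewrite leNgt dot_gt0 mx0/= => /eqP.
Unshelve. all: by end_near. Qed.

End MinimalTrace.

(** * Second variation *)

(** Fermat's rule gives g(0) = 0. If h > 0, then g(t) / t > 0 near 0, and the mean value theorem on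
    [0, e/2] gives f(e/2) > f(0). *)
Lemma second_derivative_test {R : realType} (f g : R -> R) (h : R) :
  (\forall t \near (0 : R), f t <= f 0) ->
  (\forall t \near (0 : R), is_derive (t : R) 1 f (g t)) ->
  is_derive (0 : R) 1 g h -> g 0 = 0 /\ h <= 0.
Proof.
move=> fmax df dg.
have g0 : g 0 = 0.
  have [e /= e0 He] : nbhs (0 : R) [set t : R | f t <= f 0 /\ is_derive t 1 f (g t)].
    by apply: filterS2 fmax df => t.
  have {}He t : t \in `](- e), e[ -> f t <= f 0 /\ is_derive t 1 f (g t).
    rewrite in_itv/= => /andP[te1 te2]; apply: He.
    by rewrite /ball_/= sub0r normrN ltr_norml te1.
  have in0 : 0 \in `](- e), e[ by rewrite in_itv/= e0 oppr_lt0 e0.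
  have d0 : is_derive (0 : R) 1 f 0.
    apply: (@derive1_at_max R f (- e) e 0 _ _ in0) => [|t /He[_ dft]|t /He[]//].
      by lra.
    exact: ex_derive.
  have [_ dft] := He _ in0.
  by rewrite -(@derive_val _ _ _ _ _ _ _ dft) (@derive_val _ _ _ _ _ _ _ d0).
split => //; rewrite leNgt; apply/negP => h0.
have [dg1 dg2] := dg.
have gpos : \forall t \near (0 : R), t != 0 -> 0 < t^-1 * g t.
  have cg : (fun t => t^-1 *: (g (t *: 1 + 0) - g 0)) @ (0 : R)^' --> h.
    by rewrite -dg2.
  have := cvgr_gt h cg 0 h0; rewrite near_withinE => /(_ (dnbhs_filter _)) H.
  apply: filterS H => t /[swap] t0 /(_ t0).
  by rewrite g0 subr0 addr0 /GRing.scale/= mulr1.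
have [e /= e0 He] : nbhs (0 : R) [set t : R | [/\ f t <= f 0, is_derive (t : R) 1 f (g t) &
    t != 0 -> 0 < t^-1 * g t]].
  by apply: filterS3 fmax df gpos => t.
have {}He t : 0 <= t < e -> [/\ f t <= f 0, is_derive (t : R) 1 f (g t) &
    t != 0 -> 0 < t^-1 * g t].
  by move=> /andP[t0 te]; apply: He; rewrite /ball_/= sub0r normrN ger0_norm.
have e2 : 0 < e / 2 by lra.
have cf : {within `[0, e / 2], continuous f}.
  apply: derivable_within_continuous => t; rewrite in_itv/= => /andP[t0 te].
  have [|_ dft _] := He t; first by apply/andP; split; lra.
  exact: ex_derive.
have [|t + fE] := @MVT R f g 0 (e / 2) e2 _ cf.
  move=> t; rewrite in_itv/= => /andP[t0 te].
  by have [|_ dft _] := He t; first by apply/andP; split; lra.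
rewrite in_itv/= => /andP[t0 te].
have [|_ _ /(_ (lt0r_neq0 t0)) gt] := He t; first by apply/andP; split; lra.
have [|fe _ _] := He (e / 2); first by apply/andP; split; lra.
have : 0 < g t * (e / 2 - 0).
  by rewrite subr0 mulr_gt0//; move: gt; rewrite pmulr_rgt0 ?invr_gt0.
by rewrite -fE subr_gt0 ltNge fe.
Qed.

Section Line.
Context {R : realType} {V W : normedModType R}.

(** The two difference quotients are the same function. This turns iterated directional derivatives
    into one-variable derivatives. *)
Lemma is_derive_line (X : V -> W) x w (t : R) : differentiable X (t *: w + x) ->
  is_derive t 1 (fun s => X (s *: w + x)) ('D_w X (t *: w + x)).
Proof.
move=> dX; set z := t *: w + x.
have lineE : (fun h : R => h^-1 *: (((fun s => X (s *: w + x)) \o shift t) (h *: 1) - X z)) =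
    (fun h => h^-1 *: ((X \o shift z) (h *: w) - X z)).
  by apply/funext => h; rewrite /= /z [h *: 1]mulr1 scalerDl addrA.
have dXw : derivable X z w by exact: diff_derivable.
by split; rewrite /derivable /derive lineE.
Qed.

End Line.

(** Apply [second_derivative_test] to t -> <X(x + t w), Y(y + t v)>. Moving both points at once
    produces the doubled mixed term. *)
Lemma second_variation {R : realType} {m n p : nat} (X : 'rV[R]_m -> 'rV[R]_p)
    (Y : 'rV[R]_n -> 'rV[R]_p) (U : set 'rV[R]_m) (V : set 'rV[R]_n) x y w v :
  open U -> U x -> Cn_on 2 U X -> open V -> V y -> Cn_on 2 V Y ->
  (forall x' y', U x' -> V y' -> dot (X x') (Y y') <= dot (X x) (Y y)) ->
  dot ('D_w X x) (Y y) + dot (X x) ('D_v Y y) = 0 /\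
  dot ('D_w ('D_w X) x) (Y y) + dot ('D_w X x) ('D_v Y y) *+ 2 +
    dot (X x) ('D_v ('D_v Y) y) <= 0.
Proof.
move=> oU Ux [dX dDX] oV Vy [dY dDY] max.
have lineU : \forall t \near (0 : R), U (t *: w + x).
  have : (fun t : R => t *: w + x) @ (0 : R) --> 0 *: w + x.
    by apply: cvgD; [apply: cvgZr_tmp; exact: cvg_id|exact: cvg_cst].
  by rewrite scale0r add0r; apply; exact: open_nbhs_nbhs.
have lineV : \forall t \near (0 : R), V (t *: v + y).
  have : (fun t : R => t *: v + y) @ (0 : R) --> 0 *: v + y.
    by apply: cvgD; [apply: cvgZr_tmp; exact: cvg_id|exact: cvg_cst].
  by rewrite scale0r add0r; apply; exact: open_nbhs_nbhs.
pose f (t : R) := dot (X (t *: w + x)) (Y (t *: v + y)).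
pose g (t : R) := dot ('D_w X (t *: w + x)) (Y (t *: v + y)) +
  dot (X (t *: w + x)) ('D_v Y (t *: v + y)).
have dXt (t : R) : U (t *: w + x) ->
    is_derive t 1 (fun s => X (s *: w + x)) ('D_w X (t *: w + x)).
  by move=> Ut; apply: is_derive_line; exact: dX.
have dYt (t : R) : V (t *: v + y) ->
    is_derive t 1 (fun s => Y (s *: v + y)) ('D_v Y (t *: v + y)).
  by move=> Vt; apply: is_derive_line; exact: dY.
have U0 : U (0 *: w + x) by rewrite scale0r add0r.
have V0 : V (0 *: v + y) by rewrite scale0r add0r.
have [|||g0 h0] := second_derivative_test f g
  ((dot ('D_w ('D_w X) (0 *: w + x)) (Y (0 *: v + y)) +
   dot ('D_w X (0 *: w + x)) ('D_v Y (0 *: v + y))) +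
   (dot ('D_w X (0 *: w + x)) ('D_v Y (0 *: v + y)) +
   dot (X (0 *: w + x)) ('D_v ('D_v Y) (0 *: v + y)))).
- apply: filterS2 lineU lineV => t Ut Vt.
  by rewrite /f !scale0r !add0r; exact: max.
- apply: filterS2 lineU lineV => t Ut Vt.
  exact: is_derive_dot _ _ _ _ _ _ (dXt t Ut) (dYt t Vt).
- have ddX : is_derive (0 : R) 1 (fun s => 'D_w X (s *: w + x)) ('D_w ('D_w X) (0 *: w + x)).
    by apply: is_derive_line; apply: (dDX w).1.
  have ddY : is_derive (0 : R) 1 (fun s => 'D_v Y (s *: v + y)) ('D_v ('D_v Y) (0 *: v + y)).
    by apply: is_derive_line; apply: (dDY v).1.
  exact: is_deriveD (is_derive_dot _ _ _ _ _ _ ddX (dYt 0 V0))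
    (is_derive_dot _ _ _ _ _ _ (dXt 0 U0) ddY).
move: g0 h0; rewrite /g !scale0r !add0r mulr2n => -> h; split=> //.
by move: h; rewrite !addrA.
Qed.

(** * Orthonormal frames and tangent planes *)

Section LinearAlgebra.
Context {R : realType}.

(** The frame is sought through its coordinates, as the rows of a matrix [P] such that [P *m J] has
    orthonormal rows; [P] is built one row at a time. *)
Lemma gram_schmidt {n p : nat} (J : 'M[R]_(n, p)) : row_free J ->
  exists w : 'I_n -> 'rV[R]_n, forall i j, dot (w i *m J) (w j *m J) = (i == j)%:R.
Proof.
move=> Jfree.
suff [P PJ] : exists P : 'M[R]_n, (P *m J) *m (P *m J)^T = 1%:M.
  exists (fun i => row i P) => i j.
  move/matrixP : PJ => /(_ i j); rewrite !mxE => <-.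
  by rewrite -!row_mul; apply: eq_bigr => l _; rewrite !mxE.
suff H m : (m <= n)%N -> exists P : 'M[R]_(m, n), (P *m J) *m (P *m J)^T = 1%:M by exact: H.
elim: m => [_|m IH mn].
  by exists 0; apply/matrixP => -[].
have [P PJ] := IH (ltnW mn).
have [u uP] : exists u : 'rV[R]_n, ~~ (u <= P)%MS.
  have : ~~ (1%:M <= P)%MS.
    apply/negP => /mxrankS; rewrite mxrank1 leqNgt => /negP; apply.
    by rewrite (leq_ltn_trans (rank_leq_row _)).
  by move/row_subPn => [i]; exists (row i 1%:M).
pose E := P *m J.
(* Subtracts from [u] the coordinates of the orthogonal projection of [u *m J] onto the row space of
   [E]. *)
pose u' := u - u *m J *m E^T *m P.
have u'J : u' *m J *m E^T = 0.
  by rewrite /u' !mulmxBl -(mulmxA _ P J) -/E -(mulmxA _ E) PJ mulmx1 subrr.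
have u'0 : u' *m J != 0.
  (* If [u' *m J] vanished, injectivity of [J] would give u' = 0 and put [u] in the row space of
     [P]. *)
  apply: contra uP => /eqP h; have : u' = 0 by apply: (row_free_inj Jfree); rewrite h mul0mx.
  by move/subr0_eq => ->; exact: submxMl.
pose w := (enorm (u' *m J))^-1 *: u'.
have wE : w *m J *m E^T = 0 by rewrite /w -!scalemxAl u'J scaler0.
suff H : (col_mx w P *m J) *m (col_mx w P *m J)^T = 1%:M by exists (col_mx w P).
rewrite mul_col_mx tr_col_mx mul_col_row -[P *m J]/E wE PJ.
have -> : E *m (w *m J)^T = 0 by apply: trmx_inj; rewrite trmx_mul trmxK wE trmx0.
have -> : w *m J *m (w *m J)^T = 1%:M.
  apply/matrixP => i j; rewrite !ord1 -dotE /w -!scalemxAl dotZl dotZr mulrA -expr2 exprVn.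
  by rewrite enormE mulVf ?dot_eq0// mxE.
by rewrite -scalar_mx_block.
Qed.

(** The row space of [J] lies in the orthogonal complement of span(a, b). Both have dimension n, as
    [a] and [b] are independent, so they coincide. *)
Lemma orthogonal_plane_sub {n : nat} (J : 'M[R]_(n, n.+2)) a b (e : 'rV[R]_n.+2) :
  row_free J -> dot a a = 1 -> dot b b = 1 -> -1 < dot a b < 1 ->
  (forall u, dot a (u *m J) = 0) -> (forall u, dot b (u *m J) = 0) ->
  dot a e = 0 -> dot b e = 0 -> exists v, v *m J = e.
Proof.
move=> Jfree aa bb /andP[s1 s2] aJ bJ ae be.
pose C : 'M[R]_(1 + 1, n.+2) := col_mx a b.
have dotC0 (v : 'rV[R]_n.+2) : dot a v = 0 -> dot b v = 0 -> (v <= kermx C^T)%MS.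
  move=> av bv; apply/sub_kermxP; rewrite /C tr_col_mx mul_mx_row.
  rewrite -[0](@row_mx0 R 1 1 1); congr row_mx.
    by apply/matrixP => i j; rewrite !ord1 -dotE dotC av mxE.
  by apply/matrixP => i j; rewrite !ord1 -dotE dotC bv mxE.
have Cfree : row_free C.
  apply: inj_row_free => u; rewrite -[u](@hsubmxK _ 1 1 1) /C mul_row_col.
  rewrite [lsubmx _]mx11_scalar [rsubmx _]mx11_scalar !mul_scalar_mx.
  set x := lsubmx _ _ _; set y := rsubmx _ _ _ => h.
  have := congr1 (dot a) h; rewrite dotDr !dotZr aa (dotC a 0) dot0l => h1.
  have := congr1 (dot b) h; rewrite dotDr !dotZr bb (dotC b a) (dotC b 0) dot0l => h2.
  (* The Gram determinant of [a] and [b]. *)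
  have d0 : 0 < 1 - dot a b ^+ 2 by nra.
  have x0 : x = 0.
    apply: (mulIf (lt0r_neq0 d0)); rewrite mul0r.
    rewrite (_ : _ * _ = (x * 1 + y * dot a b) - dot a b * (x * dot a b + y * 1));
      last by ring.
    by rewrite h1 h2 mulr0 subrr.
  have y0 : y = 0 by move: h2; rewrite x0 mul0r add0r mulr1.
  by rewrite x0 y0 raddf0 row_mx0.
have JK : (J <= kermx C^T)%MS.
  by apply/row_subP => i; rewrite rowE; apply: dotC0.
have : (kermx C^T <= J)%MS.
  rewrite -(mxrank_leqif_sup JK) mxrank_ker mxrank_tr (eqP Cfree) (eqP Jfree).
  by rewrite subn2.
move=> /(submx_trans (dotC0 e ae be)) /submxP[v ->]; by exists v.
Qed.

End LinearAlgebra.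

(** Differentiate <X, 'D_w X> = 0 along [w]. *)
Lemma param_second_derivative {R : realType} {n : nat} (X : 'rV[R]_n -> 'rV[R]_n.+2)
    (U : set 'rV[R]_n) x w :
  open U -> U x -> (forall y, sphere (X y)) -> Cn_on 2 U X ->
  dot (X x) ('D_w ('D_w X) x) = - dot ('D_w X x) ('D_w X x).
Proof.
move=> oU Ux sX [dX dDX].
have dXw : is_derive x w X ('D_w X x).
  by apply/derivableP; apply: diff_derivable; exact: dX.
have ddXw : is_derive x w ('D_w X) ('D_w ('D_w X) x).
  by apply/derivableP; apply: diff_derivable; apply: (dDX w).1.
have := @derive_val _ _ _ _ _ _ _ (is_derive_dot _ _ _ _ _ _ dXw ddXw).
rewrite (@near_eq_derive R _ _ _ (cst 0)); last first.
  near=> y; have Uy : U y by near: y; apply: open_nbhs_nbhs.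
  have dXy := dX y Uy; rewrite deriveE//; exact: (sphere_param_tangent X y w sX dXy).
by rewrite derive_cst => h; lra.
Unshelve. all: by end_near. Qed.

(** Here [p] and [q] stand for the second derivatives of the two parametrizations along a common
    unit tangent vector, whose squared norm is the 1 in the mixed term. *)
Lemma dot_combine {R : realType} {n : nat} (a b p q : 'rV[R]_n) (s : R) :
  dot a p = -1 -> dot b q = -1 -> dot p b + 1 *+ 2 + dot a q <= 0 ->
  dot (b - s *: a) p + dot (a - s *: b) q <= - (2 * (1 - s)).
Proof. by rewrite !dotBl !dotZl (dotC p) => -> ->; rewrite mulr2n => h; lra. Qed.

Lemma minimal_param_no_max {R : realType} {n : nat}
    (X Y : 'rV[R]_n -> 'rV[R]_n.+2) (U V : set 'rV[R]_n) x y :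
  (0 < n)%N ->
  open U -> U x -> (forall z, sphere (X z)) -> Cn_on 2 U X ->
  injective ('d X x) -> minimal_param X U ->
  open V -> V y -> (forall z, sphere (Y z)) -> Cn_on 2 V Y ->
  injective ('d Y y) -> minimal_param Y V ->
  -1 < dot (X x) (Y y) < 1 ->
  ~ (forall x' y', U x' -> V y' -> dot (X x') (Y y') <= dot (X x) (Y y)).
Proof.
move=> n0 oU Ux sX cX injX minX oV Vy sY cY injY minY s11 max.
have dX : differentiable X x := cX.1 x Ux.
have dY : differentiable Y y := cY.1 y Vy.
have var := second_variation X Y U V x y.
(* Keeping one point fixed, with direction 0, separates the two first-order conditions. *)
have dXb w : dot ('d X x w) (Y y) = 0.
  have [+ _] := var w 0 oU Ux cX oV Vy cY max.
  by rewrite derive0 dotC (dotC (X x)) dot0l addr0 (deriveE _ dX) dotC.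
have dYa v : dot (X x) ('d Y y v) = 0.
  have [+ _] := var 0 v oU Ux cX oV Vy cY max.
  by rewrite derive0 dot0l add0r (deriveE _ dY).
pose JX := lin1_mx ('d X x); pose JY := lin1_mx ('d Y y).
have JXE u : u *m JX = 'd X x u by rewrite mul_rV_lin1.
have JYE u : u *m JY = 'd Y y u by rewrite mul_rV_lin1.
have JXfree : row_free JX.
  by apply: inj_row_free => u; rewrite JXE => h; apply: injX; rewrite h linear0.
have JYfree : row_free JY.
  by apply: inj_row_free => u; rewrite JYE => h; apply: injY; rewrite h linear0.
have [w wP] := gram_schmidt JX JXfree.
have frX : orthonormal_frame (k := n.+1) X x w.
  by move=> i j; rewrite -!JXE wP.
set a := X x in s11 dYa *; set b := Y y in s11 dXb *.
have aa : dot a a = 1 by exact: sX.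
have bb : dot b b = 1 by exact: sY.
have adX u : dot a ('d X x u) = 0 by exact: (sphere_param_tangent X x u sX dX).
have bdY u : dot b ('d Y y u) = 0 by exact: (sphere_param_tangent Y y u sY dY).
have aJY u : dot a (u *m JY) = 0 by rewrite JYE.
have bJY u : dot b (u *m JY) = 0 by rewrite JYE.
have bdX u : dot b ('d X x u) = 0 by rewrite dotC.
(* Both tangent planes are the complement of span(a, b), so each frame vector at [a] is also tangent
   at [b]; [v i] is its coordinate vector there. *)
have spanY i : exists v, v *m JY = 'd X x (w i).
  exact: (orthogonal_plane_sub JY a b _ JYfree aa bb s11 aJY bJY (adX _) (bdX _)).
have [v vP] := choice spanY.
have vwE i : 'd Y y (v i) = 'd X x (w i).
  exact: etrans (esym (JYE (v i))) (vP i).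
have frY : orthonormal_frame (k := n.+1) Y y v.
  by move=> i j; exact: etrans (congr2 (@dot R n.+2) (vwE i) (vwE j)) (frX i j).
set s := dot a b in s11.
have ba : dot b a = s by rewrite dotC.
(* The squared norm is 1 - s^2. The vectors b - s a and a - s b are the normals at [a] and [b] to
   which minimality is applied. *)
have normal_neq0 (c d : 'rV[R]_n.+2) :
    dot c c = 1 -> dot d d = 1 -> dot c d = s -> d - s *: c != 0.
  move=> cc dd cd; rewrite -dot_eq0 !(dotBl, dotBr, dotZl, dotZr) cc dd cd (dotC d) cd.
  by rewrite gt_eqF//; case/andP: s11 => *; nra.
have nXa : dot (b - s *: a) a = 0 by rewrite dotBl dotZl aa ba mulr1 subrr.
have nYb : dot (a - s *: b) b = 0 by rewrite dotBl dotZl bb mulr1 subrr.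
have nXT u : dot (b - s *: a) ('d X x u) = 0.
  by rewrite dotBl dotZl (adX u) (bdX u) mulr0 subrr.
have nYT u : dot (a - s *: b) ('d Y y u) = 0.
  by rewrite dotBl dotZl (bdY u) (dYa u) mulr0 subrr.
have tX := minimal_trace X U x _ w n0 oU Ux sX cX injX minX
  (normal_neq0 _ _ aa bb erefl) nXa nXT frX.
have tY := minimal_trace Y V y _ v n0 oV Vy sY cY injY minY
  (normal_neq0 _ _ bb aa ba) nYb nYT frY.
have eX i : dot a ('D_(w i) ('D_(w i) X) x) = -1.
  by rewrite (param_second_derivative X U x _ oU Ux sX cX) (deriveE _ dX) frX eqxx.
have eY i : dot b ('D_(v i) ('D_(v i) Y) y) = -1.
  by rewrite (param_second_derivative Y V y _ oV Vy sY cY) (deriveE _ dY) frY eqxx.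
have crossE i : dot ('D_(w i) X x) ('D_(v i) Y y) = 1.
  have vE := etrans (deriveE (v i) dY) (vwE i).
  by have := etrans (congr2 (@dot R n.+2) (deriveE (w i) dX) vE) (frX i i); rewrite eqxx.
have le2 i : dot (b - s *: a) ('D_(w i) ('D_(w i) X) x) +
    dot (a - s *: b) ('D_(v i) ('D_(v i) Y) y) <= - (2 * (1 - s)).
  have [_] := var (w i) (v i) oU Ux cX oV Vy cY max.
  rewrite crossE; exact: dot_combine (eX i) (eY i).
(* Both traces vanish by minimality, so summing [le2] bounds 0 by n times a negative number, with n
   > 0. *)
have : 0 <= \sum_(i < n) - (2 * (1 - s)).
  rewrite -[leLHS](etrans (congr2 +%R tX tY) (addr0 0)) -big_split.
  by apply: ler_sum => i _; exact: le2.
rewrite sumr_const card_ord pmulrn_lge0// oppr_ge0 leNgt mulr_gt0// subr_gt0.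
by have /andP[] := s11.
Qed.

(** * Back to hypersurfaces and geodesic balls *)

Lemma Cn_onW {R : realType} {m p : nat} (N : nat)
    (U V : set 'rV[R]_m) (f : 'rV[R]_m -> 'rV[R]_p) :
  V `<=` U -> Cn_on N U f -> Cn_on N V f.
Proof.
move=> VU; elim: N f => [|N IH] f /=; first by move=> h x /VU /h.
by move=> [df dDf]; split => [x /VU /df//|v]; exact: IH.
Qed.

Lemma image_of_sphere {R : realType} {k : nat} (M : hypersurface R k) :
  image_of M `<=` @sphere R k.
Proof. by move=> _ [p _ <-]; exact: imm_sphere. Qed.

(** Take a chart around a preimage of [a] and shrink its image by continuity so that [X] stays in
    [O]. Since [chart_inv] is total, [X] takes values in the image of [M] even outside [U]. *)
Lemma local_param {R : realType} {n : nat} (M : hypersurface R n.+1)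
    (a : 'rV[R]_n.+2) (O : set 'rV[R]_n.+2) :
  minimal M -> image_of M a -> nbhs a O ->
  exists (X : 'rV[R]_n -> 'rV[R]_n.+2) (U : set 'rV[R]_n) (x : 'rV[R]_n),
  [/\ X x = a, open U, U x, Cn_on 2 U X & injective ('d X x)] /\
  [/\ minimal_param X U, forall y, image_of M (X y) & forall y, U y -> O (X y)].
Proof.
move=> minM [p _ pa] Oa; have [c cM cp] := atlas_cover p.
pose X : 'rV[R]_n -> 'rV[R]_n.+2 := @imm R n.+1 M \o chart_inv c.
pose U1 : set 'rV[R]_n := chart_img c.
pose x : 'rV[R]_n := chart_map c p.
have U1x : U1 x by exists p.
have oU1 : open U1 by exact: chart_img_open.
have cX : Cn_on 2 U1 X by exact: (imm_smooth cM 2).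
have Xx : X x = a by rewrite /X/= chart_mapK.
pose U := (U1 `&` X @^-1` O)^°.
have UU1 : U `<=` U1 by move=> y /interior_subset[].
exists X, U, x; split; split => //.
- exact: open_interior.
- apply: filterI; first exact: open_nbhs_nbhs.
  have /differentiable_continuous := cX.1 x U1x.
  by apply; rewrite Xx.
- exact: Cn_onW UU1 cX.
- exact: imm_immersive.
- move=> W N oW WU; apply: (minM c cM W N oW).
  exact: subset_trans WU UU1.
- by move=> y; exists (chart_inv c y).
- by move=> y /interior_subset[].
Qed.

(** Off the boundary, [a] avoids the closure of the complement of the ball in the sphere. The
    neighbourhood is ambient, hence the condition [sphere y]. *)
Lemma geoball_interior {R : realType} {k : nat} (nu a : 'rV[R]_k.+1) (r : R) :
  sphere a -> geoball_closure nu r a -> ~ geoball_boundary nu r a ->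
  geoball nu r a /\ nbhs a [set y | sphere y -> geoball nu r y].
Proof.
move=> sa ca nba.
have nca : ~ closure (@sphere R k `\` geoball nu r) a by move=> h; apply: nba.
split.
  by apply: contrapT => nb; apply: nca; apply: subset_closure.
have /existsNP[B /not_implyP[Ba /set0P/negP/negPn/eqP B0]] := nca.
apply: filterS Ba => y By sy; apply: contrapT => nby.
have : ((@sphere R k `\` geoball nu r) `&` B) y by split.
by rewrite B0.
Qed.

(** A ball of radius at most pi/2 lies in an open hemisphere, which contains no antipodal pair. *)
Lemma geoball_dot_gt0 {R : realType} {k : nat} (nu p : 'rV[R]_k.+1) (r : R) :
  (0 < k)%N -> r <= pi / 2 -> sphere nu -> geoball nu r p -> 0 < dot p nu.
Proof.
move=> k0 hr hnu [sp]; rewrite geodistE// => pr; rewrite ltNge; apply/negP => p0.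
have : acos 0 <= acos (dot p nu).
  by apply: acos_le => //; [exact: dot_unit_bound|rewrite lerN10 ler01].
by rewrite acos0 leNgt (lt_le_trans pr hr).
Qed.

Theorem lemma1 (R : realType) (k : nat) (hk : (2 <= k)%N)
    (M1 M2 : hypersurface R k)
    (cpt1 : compact_hypersurface M1) (cpt2 : compact_hypersurface M2)
    (min1 : minimal M1) (min2 : minimal M2)
    (nu : 'rV[R]_k.+1) (hnu : sphere nu) (r : R) (hr : r <= pi / 2)
    (meet1 : image_of M1 `&` geoball nu r !=set0)
    (meet2 : image_of M2 `&` geoball nu r !=set0)
    (disj : image_of M1 `&` image_of M2 `&` geoball_closure nu r = set0)
    (a b : 'rV[R]_k.+1)
    (ha : (image_of M1 `&` geoball_closure nu r) a)
    (hb : (image_of M2 `&` geoball_closure nu r) b)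
    (hab : dist_in (geoball_closure nu r) (image_of M1) (image_of M2)
           = geodist a b) :
  geoball_boundary nu r a \/ geoball_boundary nu r b.
Proof.
destruct k as [|n] => //.
have [M1a ca] := ha; have [M2b cb] := hb.
have sa := image_of_sphere M1 a M1a; have sb := image_of_sphere M2 b M2b.
apply: contrapT => /not_orP[nba nbb].
have [Ba nbhsa] := geoball_interior nu a r sa ca nba.
have [Bb nbhsb] := geoball_interior nu b r sb cb nbb.
have a0 := geoball_dot_gt0 nu a r (ltn0Sn n) hr hnu Ba.
have b0 := geoball_dot_gt0 nu b r (ltn0Sn n) hr hnu Bb.
have sab := dot_unit_bound a b sa sb.
have s_lt1 : dot a b < 1.
  rewrite lt_neqAle (andP sab).2 andbT; apply/eqP => /(dot_eq1 _ _ sa sb) eqab.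
  suff : set0 a by [].
  by rewrite -disj; split => //; split => //; rewrite eqab.
(* If a = -b, then <a,nu> and <b,nu> could not both be positive. *)
have s_gtN1 : -1 < dot a b.
  rewrite lt_neqAle (andP sab).1 andbT; apply/eqP => sN1.
  have eqab : a = - b by apply: dot_eq1; rewrite ?dotNl ?dotNr ?opprK// -sN1 opprK.
  by move: a0; rewrite eqab dotNl oppr_gt0 ltNge ltW.
(* As acos is decreasing, minimal distance means maximal inner product. *)
have le_dot p q : (image_of M1 `&` geoball nu r) p -> (image_of M2 `&` geoball nu r) q ->
    dot p q <= dot a b.
  move=> [M1p Bp] [M2q Bq]; have [sp _] := Bp; have [sq _] := Bq.
  have : geodist a b <= geodist p q.
    rewrite -hab; apply: ge_inf.
      exists 0 => _ [u [Mu _]] [v [Mv _]] <-.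
      have su := image_of_sphere M1 u Mu; have sv := image_of_sphere M2 v Mv.
      by rewrite geodistE// acos_ge0// dot_unit_bound.
    exists p; first by split => //; exact: subset_closure.
    by exists q => //; split => //; exact: subset_closure.
  rewrite !geodistE// => le_acos; have spq := dot_unit_bound p q sp sq.
  rewrite leNgt; apply/negP => lt_dot.
  (* A larger inner product would make the two arccosines equal, and taking cosines contradicts the
     strict inequality. *)
  have eq_acos : acos (dot p q) = acos (dot a b).
    by apply/le_anti; rewrite le_acos andbT acos_le// ltW.
  by move: lt_dot; rewrite -[ltRHS]acosK ?in_itv// eq_acos acosK ?in_itv// ltxx.
have [X [U [x [[Xx oU Ux cX injX] [minX MX OX]]]]] := local_param M1 a _ min1 M1a nbhsa.
have [Y [V [y [[Yy oV Vy cY injY] [minY MY OY]]]]] := local_param M2 b _ min2 M2b nbhsb.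
have sX z : sphere (X z) := image_of_sphere M1 _ (MX z).
have sY z : sphere (Y z) := image_of_sphere M2 _ (MY z).
have n0 : (0 < n)%N by exact: hk.
have s11 : -1 < dot (X x) (Y y) < 1 by rewrite Xx Yy s_gtN1.
apply: (minimal_param_no_max X Y U V x y n0 oU Ux sX cX injX minX oV Vy sY cY injY minY s11).
move=> x' y' Ux' Vy'; rewrite Xx Yy; apply: le_dot; split.
- exact: MX.
- exact: OX.
- exact: MY.
- exact: OY.
Qed.
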